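(* Let $\mathbb{F}_q$ be a finite field with $q$ elements. Let $\lambda/\mu$ be a ribbon, and let $s_{\lambda/\mu}$ be the corresponding skew Schur function. Let $a \in \mathbb{F}_q$. Then $$P(s_{\lambda/\mu} \mapsto a) = \frac{1}{q}.$$
   Context: A partition is a weakly decreasing finite sequence of positive integers $\lambda = (\lambda_1, \ldots, \lambda_k)$; its length is $\ell(\lambda) = k$, and one sets $\lambda_i := 0$ for $i > k$. Its Young diagram is $Y(\lambda) = \{(i,j) : 1 \leq i \leq k,\ 1 \leq j \leq \lambda_i\}$, whose elements are pictured as unit square boxes, $(i,j)$ being the $j$-th box from the left in the $i$-th row from the top. A skew partition $\lambda/\mu$ is a pair of partitions $(\lambda,\mu)$ with $\mu_i \leq \lambda_i$ for all $i \geq 1$; its (skew Young) diagram is $Y(\lambda/\mu) = Y(\lambda) \setminus Y(\mu)$. A skew partition $\lambda/\mu$ is connected if the interior of its diagram (regarded as the union of its boxes) is connected. A ribbon is a connected skew partition whose diagram does not contain any $2 \times 2$ block of boxes. Let $\mathcal{P} = \mathbb{Z}[h_1, h_2, h_3, \ldots]$ be the polynomial ring in countably many indeterminates, with $h_0 := 1$ and $h_m := 0$ for $m < 0$. For a skew partition $\lambda/\mu$ with $k = \ell(\lambda)$, the skew Schur function is $s_{\lambda/\mu} := \det\left( h_{\lambda_i - \mu_j - i + j} \right)_{1 \leq i,j \leq k} \in \mathcal{P}$. For $f \in \mathcal{P}$ and $a \in \mathbb{F}_q$, choose $N$ such that $f$ involves only $h_1, \ldots, h_N$; then the probability of $f$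 evaluating to $a$ is $$P(f \mapsto a) := \frac{\#\{(z_1, \ldots, z_N) \in \mathbb{F}_q^N \mid f(z_1, \ldots, z_N) = a\}}{q^N},$$ where the integer coefficients of $f$ are mapped to $\mathbb{F}_q$. This does not depend on the choice of $N$. *)

(* Defs.v *)
From mathcomp Require Import all_boot all_order all_algebra finmap.
From mathcomp Require Import multinomials.monalg.
From mathcomp Require Import classical_sets reals topology normedtype.

Set Implicit Arguments.
Unset Strict Implicit.
Unset Printing Implicit Defensive.

Import GRing.Theory Num.Theory.
Import numFieldNormedType.Exports.

Local Open Scope classical_set_scope.
Local Open Scope ring_scope.

(* Rows, columns and parts are numbered from 0: the part lambda_(i+1) is
   [nth 0 lam i], which is 0 beyond the length, and the box of the paper's
   position (i+1, j+1) is the pair (i, j). *)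

Definition is_partition (lam : seq nat) : bool :=
  sorted geq lam && all (fun x => 0 < x)%N lam.

Definition is_skew_partition (lam mu : seq nat) : Prop :=
  [/\ is_partition lam, is_partition mu
    & forall i, (nth 0%N mu i <= nth 0%N lam i)%N].

Definition young_diagram (lam : seq nat) : set (nat * nat) :=
  [set b | (b.2 < nth 0%N lam b.1)%N].

Definition skew_diagram (lam mu : seq nat) : set (nat * nat) :=
  young_diagram lam `\` young_diagram mu.

(* The closed unit square of a box; the first coordinate of the plane runs
   down the rows, the second one along the columns. *)
Definition box (R : realType) (b : nat * nat) : set (R * R) :=
  [set p | b.1%:R <= p.1 <= b.1.+1%:R /\ b.2%:R <= p.2 <= b.2.+1%:R].
Arguments box : clear implicits.

Definition diagram_region (R : realType) (D : set (nat * nat)) : set (R * R) :=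
  \bigcup_(b in D) box R b.
Arguments diagram_region : clear implicits.

(* The library's [connected] holds of the empty set, which does not count as
   connected here: the empty diagram is not a ribbon (its Schur function
   is 1). *)
Definition is_connected_diagram (R : realType) (D : set (nat * nat)) : Prop :=
  (interior (diagram_region R D)) !=set0 /\
  connected (interior (diagram_region R D)).

Definition has_2x2_block (D : set (nat * nat)) : Prop :=
  exists i j : nat, [/\ D (i, j), D (i, j.+1), D (i.+1, j) & D (i.+1, j.+1)].

Definition is_ribbon (R : realType) (lam mu : seq nat) : Prop :=
  [/\ is_skew_partition lam mu,
      is_connected_diagram R (skew_diagram lam mu)
    & ~ has_2x2_block (skew_diagram lam mu)].

(* Z[h_1, h_2, ...]: the indeterminate numbered i : nat stands for h_(i+1). *)
Definition hpoly : comNzRingType := {malg int[{cmonom nat}]}.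

Definition hvar (m : int) : hpoly :=
  match m with
  | Posz 0 => 1
  | Posz i.+1 => << ucm i >>
  | Negz _ => 0
  end.

Definition skew_schur (lam mu : seq nat) : hpoly :=
  \det (\matrix_(i < size lam, j < size lam)
          hvar ((nth 0%N lam i)%:Z - (nth 0%N mu j)%:Z - i%:Z + j%:Z)).

Definition involves_only (N : nat) (f : hpoly) : Prop :=
  forall m, m \in msupp f -> forall i, i \in finsupp m -> (i < N)%N.

Definition nvars (f : hpoly) : nat :=
  (\max_(m <- msupp f) \max_(i <- finsupp m) i.+1)%N.

(* f(z_1, ..., z_N); only meaningful when f involves only h_1, ..., h_N. *)
Definition eval_at (F : comNzRingType) (N : nat) (z : 'rV[F]_N) (f : hpoly) : F :=
  mmap (fun c : int => c%:~R)
       (fun m : {cmonom nat} => \prod_(i < N) z 0 i ^+ m i) f.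

Definition prob_with (F : finFieldType) (N : nat) (f : hpoly) (a : F) : rat :=
  #|[set z : 'rV[F]_N | eval_at z f == a]%SET|%:R / (#|F| ^ N)%:R.

Definition prob (F : finFieldType) (f : hpoly) (a : F) : rat :=
  prob_with (nvars f) f a.

(* [nvars f] is an admissible number of indeterminates, and every other
   admissible choice gives the same probability. *)

Lemma involves_only_nvars (f : hpoly) : involves_only (nvars f) f.
Proof.
move=> m mf i im; rewrite /nvars.
rewrite (big_rem m mf) /= leq_max; apply/orP; left.
by rewrite (big_rem i im) /= leq_max leqnn.
Qed.

Lemma nvars_le (N : nat) (f : hpoly) : involves_only N f -> (nvars f <= N)%N.
Proof.
move=> fN; rewrite /nvars big_seq; apply: (big_ind (fun n => (n <= N)%N)) => //.
  by move=> x y xN yN; rewrite geq_max xN.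
move=> m mf; rewrite big_seq; apply: (big_ind (fun n => (n <= N)%N)) => //.
  by move=> x y xN yN; rewrite geq_max xN.
by move=> i im; apply: fN mf _ im.
Qed.

Lemma prob_withD (F : finFieldType) (N k : nat) (f : hpoly) (a : F) :
  involves_only N f -> prob_with (N + k) f a = prob_with N f a.
Proof.
move=> fN.
have ev (x : 'rV[F]_N) (y : 'rV[F]_k) :
    eval_at (row_mx x y) f = eval_at x f.
  rewrite /eval_at !mmapE; apply: eq_big_seq => m mf; congr (_ * _).
  rewrite big_split_ord /= [X in _ * X]big1 ?mulr1 => [|i _].
    by apply: eq_bigr => i _; rewrite row_mxEl.
  have /eqP -> : m (N + i)%N == 0%N; last by rewrite expr0.
  rewrite cmE_eq0; apply/negP => /(fN _ mf).
  by rewrite ltnNge leq_addr.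
rewrite /prob_with.
have -> : #|[set z : 'rV[F]_(N + k) | eval_at z f == a]%SET| =
          (#|[set x : 'rV[F]_N | eval_at x f == a]%SET| * #|F| ^ k)%N.
  have <- : #|[set: 'rV[F]_k]%SET| = (#|F| ^ k)%N.
    by rewrite cardsT card_mx mul1n.
  rewrite -cardsX -(@card_imset _ _ (fun p => row_mx p.1 p.2)).
    apply: eq_card => z; rewrite inE; apply/idP/imsetP => [za|[[x y]]].
      exists (lsubmx z, rsubmx z); last by rewrite hsubmxK.
      by rewrite !inE andbT -(ev _ (rsubmx z)) hsubmxK.
    by rewrite !inE andbT /= => xa ->; rewrite ev.
  by move=> [x y] [x' y'] /= /eq_row_mx[-> ->].
have F0 n : (#|F| ^ n)%:R != 0 :> rat.
  by rewrite pnatr_eq0 -lt0n expn_gt0; apply/orP; left; apply/card_gt0P; exists 0.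
by rewrite expnD !natrM invfM mulrACA divff // mulr1.
Qed.

Lemma prob_with_eq (F : finFieldType) (N : nat) (f : hpoly) (a : F) :
  involves_only N f -> prob_with N f a = prob f a.
Proof.
move=> fN; rewrite -(subnKC (nvars_le fN)).
exact/prob_withD/involves_only_nvars.
Qed.

(* Main.v *)
(** Put a_i = lambda_i - i and b_j = mu_j - j. If r, ..., s are the nonempty
    rows of the ribbon, then a_i = b_i outside [r, s] and a_(i+1) = b_i for
    r <= i < s, because consecutive rows of a ribbon overlap in exactly one
    column. Hence in every term of the Leibniz expansion of
    det (h_(a_i - b_j)) the indices add up to n = a_r - b_s, the number of
    boxes, so h_n can only occur multiplied by copies of h_0 = 1, and since a_r
    differs from every b_j this happens for a single permutation. So
    s_(lambda/mu) = +-h_n + (a polynomial in h_1, ..., h_(n-1)), and translating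
    z_n permutes the fibres of the evaluation map transitively. *)

Require Import Defs.
From HB Require Import structures.
From mathcomp Require Import all_boot all_order all_algebra finmap perm.
From mathcomp Require Import zify lra.
From mathcomp Require Import multinomials.monalg.
From mathcomp Require Import classical_sets topology normedtype reals.

Set Implicit Arguments.
Unset Strict Implicit.
Unset Printing Implicit Defensive.

Import Order.TTheory GRing.Theory Num.Theory.
Import numFieldNormedType.Exports.

Local Open Scope ring_scope.

(** * The top index in determinants with entries [g (a i - b j)] *)

Section TopVariable.
Variables (A : comNzRingType) (k : nat) (a b : 'I_k -> int).
Variables (sigma : {perm 'I_k}) (r : 'I_k) (g g' : int -> A).
Let n := a r - b (sigma r).
Hypotheses (b_inj : injective b) (aE : forall i, i != r -> a i = b (sigma i)).
Hypotheses (a_r : forall j, a r != b j) (n_gt0 : 0 < n).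
Hypotheses (g0 : g 0 = 1) (g_lt0 : forall m, m < 0 -> g m = 0).
Hypothesis gg' : forall m, m != n -> g' m = g m.

Lemma sum_index (tau : {perm 'I_k}) : \sum_i (a i - b (tau i)) = n.
Proof.
rewrite sumrB -(reindex_inj (h := tau) (F := b) (P := xpredT)) /=; last exact: perm_inj.
rewrite (reindex_inj (h := sigma) (F := b) (P := xpredT)) /=; last exact: perm_inj.
rewrite -sumrB (bigD1 r) //= big1 ?addr0 // => i ir.
by rewrite aE // subrr.
Qed.

(** Nonnegative indices summing to [n] vanish outside [i0] once the one at [i0] is [n]; as [a r]
    avoids every [b j], this forces [i0 = r]. *)
Lemma index_eq_top (tau : {perm 'I_k}) (i0 : 'I_k) :
  (forall i, 0 <= a i - b (tau i)) -> a i0 - b (tau i0) = n -> tau = sigma.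
Proof.
move=> ge0 top.
have zero i : i != i0 -> a i = b (tau i).
  move=> ii0; apply/eqP; rewrite -subr_eq0; apply/eqP.
  have s0 : \sum_(j | j != i0) (a j - b (tau j)) = 0.
    by have := sum_index tau; rewrite (bigD1 i0) //= top => /(canRL (addKr _)) ->;
       rewrite addNr.
  exact: (psumr_eq0P _ s0).
have i0r : i0 = r.
  apply/eqP; apply/negPn/negP => ne.
  by move: (a_r (tau r)); rewrite zero ?eqxx // eq_sym.
subst i0.
have tE i : i != r -> tau i = sigma i.
  by move=> ir; apply: b_inj; rewrite -zero // aE.
apply/permP => i; have [->|/tE //] := eqVneq i r.
(* Permutations agreeing off [r] agree at [r]: if [j] were not [r], then [tau j = tau r] would
   contradict injectivity. *)
set j := ((sigma^-1)%g (tau r)).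
have sj : sigma j = tau r by rewrite /j permKV.
have [jr|jr] := eqVneq j r; first by rewrite -sj jr.
by move: (tE j jr); rewrite sj => /perm_inj jr'; rewrite jr' eqxx in jr.
Qed.

Lemma det_top_index :
  \det (\matrix_(i, j) g' (a i - b j)) =
  \det (\matrix_(i, j) g (a i - b j)) + (-1) ^+ sigma * (g' n - g n).
Proof.
rewrite /determinant (bigD1 sigma) //= [in RHS](bigD1 sigma) //=.
have prodE h : h 0 = 1 -> \prod_i (\matrix_(i, j) h (a i - b j)) i (sigma i) = h n :> A.
  move=> h0; rewrite (bigD1 r) //= mxE big1 ?mulr1 // => i ir.
  by rewrite mxE aE // subrr.
rewrite !prodE //; last by rewrite gg' // lt_eqF.
rewrite (eq_bigr (fun s : {perm 'I_k} =>
  (-1) ^+ s * \prod_i (\matrix_(i, j) g (a i - b j)) i (s i))); last first.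
  move=> tau ts; congr (_ * _).
  (* A negative index kills the term on both sides; otherwise an index [n] would force
     [tau = sigma]. *)
  have [/existsP[i0 lt0]|/existsPn ge0] := boolP [exists i, a i - b (tau i) < 0].
    rewrite (bigD1 i0) //= [in RHS](bigD1 i0) //= !mxE gg' ?g_lt0 ?mul0r //.
    by rewrite lt_eqF // (lt_trans lt0).
  apply: eq_bigr => i _; rewrite !mxE gg' //.
  apply: contra ts => /eqP top; apply/eqP; apply: index_eq_top top => j.
  by rewrite leNgt.
by rewrite mulrBr [RHS]addrC addrA subrK.
Qed.

End TopVariable.

(** * Equal fibres and the evaluation morphism *)

Lemma card_fiber_translation (V : finZmodType) (F : finFieldType) (f : V -> F)
    (u : F -> V) (c a : F) :
  c != 0 -> (forall z t, f (z + u t) = f z + c * t) ->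
  (#|[set z | f z == a]%SET| * #|F| = #|V|)%N.
Proof.
move=> c0 fu.
have le_fiber x y : (#|[set z | f z == x]%SET| <= #|[set z | f z == y]%SET|)%N.
  (* With [c * t = y - x], translation by [u t] embeds the fibre over [x] into the one over [y]. *)
  set t := c^-1 * (y - x).
  rewrite -(card_imset _ (addIr (u t))); apply/subset_leq_card/fintype.subsetP => w.
  case/imsetP => z; rewrite !inE => /eqP fz ->.
  by rewrite fu fz /t mulVKf // addrC subrK.
have -> : #|V| = (\sum_(x : F) #|[set z | f z == x]%SET|)%N.
  rewrite -sum1_card (partition_big f xpredT) //=.
  by apply: eq_bigr => x _; rewrite -sum1_card; apply: eq_bigl => z; rewrite !inE.
rewrite [RHS](eq_bigr (fun=> #|[set z | f z == a]%SET|)) => [|x _].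
  by rewrite sum_nat_const mulnC.
by apply/eqP; rewrite eqn_leq !le_fiber.
Qed.

Section Evaluation.
Variables (F : comNzRingType) (N : nat) (z : 'rV[F]_N).

Let monom_at (m : {cmonom nat}) : F := \prod_(i < N) z 0 i ^+ m i.

Fact monom_at_mmorphism : mmorphism monom_at.
Proof.
split=> [m1 m2|]; rewrite /monom_at.
  by rewrite -big_split; apply: eq_bigr => i _; rewrite cmM exprD.
by apply: big1 => i _; rewrite cm1 expr0.
Qed.
HB.instance Definition _ := isMultiplicative.Build _ _ monom_at monom_at_mmorphism.

(** As a ring morphism, evaluation passes through the Jacobi-Trudi determinant. *)
HB.instance Definition _ :=
  GRing.RMorphism.copy (@eval_at F N z) (mmap (intmul 1) monom_at).

Lemma eval_at_hvar (i : 'I_N) : eval_at z (hvar i.+1%:Z) = z 0 i.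
Proof.
rewrite /eval_at mmapU mul1r (bigD1 i) //= cmUU expr1 big1 ?mulr1 // => j ji.
by rewrite cmU -val_eqE eq_sym in ji *; rewrite (negbTE ji).
Qed.
End Evaluation.

(** * The shape of a ribbon *)

Lemma nth_partition_antitone (lam : seq nat) (i j : nat) :
  is_partition lam -> (i <= j)%N -> (nth 0%N lam j <= nth 0%N lam i)%N.
Proof.
case/andP => slam _ ij; have [jl|lj] := ltnP j (size lam); last by rewrite nth_default.
have geq_trans : transitive geq by move=> x y w xy yw; apply: leq_trans yw xy.
have geq_refl : reflexive geq by move=> x; exact: leqnn.
apply: (sorted_leq_nth geq_trans geq_refl 0%N slam) => //.
exact: leq_ltn_trans jl.
Qed.

Lemma skew_diagramP (lam mu : seq nat) (i j : nat) :
  skew_diagram lam mu (i, j) <-> (nth 0 mu i <= j < nth 0 lam i)%N.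
Proof.
rewrite /skew_diagram /young_diagram /=; split=> [[jl /negP]|/andP[mj jl]].
  by rewrite -leqNgt jl => ->.
by split=> //; apply/negP; rewrite -leqNgt.
Qed.

Lemma box_center_interior (R : realType) (D : set (nat * nat)) (i j : nat) :
  D (i, j) -> interior (diagram_region R D) (i%:R + 2^-1, j%:R + 2^-1).
Proof.
move=> Dij; apply/nbhs_ballP; exists 2^-1 => /=; first by rewrite invr_gt0.
move=> [x y] [/=]; rewrite /ball /= !ltr_distlC => /andP[x1 x2] /andP[y1 y2].
exists (i, j) => //; rewrite /box /= -!natr1; split; lra.
Qed.

(* If rows [i] and [i.+1] share no column, then in passing from the boxes of
   the rows up to [i] to those below, the functional [p.2 - p.1] has to take
   its value at the corner (i + 1, mu_i), the only point of the region on that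
   diagonal, and that corner is not interior. *)
Lemma connected_rows_overlap (R : realType) (lam mu : seq nat) (i u v : nat) :
  is_skew_partition lam mu -> is_connected_diagram R (skew_diagram lam mu) ->
  (u <= i < v)%N -> (nth 0 mu u < nth 0 lam u)%N -> (nth 0 mu v < nth 0 lam v)%N ->
  (nth 0 mu i < nth 0 lam i.+1)%N.
Proof.
move=> [plam pmu _] [_ conn] /andP[ui iv] rowu rowv.
rewrite ltnNge; apply/negP => sep.
set c := nth 0%N mu i in sep *.
set O := interior _ in conn.
(* Monotonicity of [mu] and [lam] confines the region to two opposite quadrants at the corner
   [(i + 1, c)]. *)
have region (x y : R) : diagram_region R (skew_diagram lam mu) (x, y) ->
    x <= i.+1%:R /\ c%:R <= y \/ i.+1%:R <= x /\ y <= c%:R.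
  move=> [[p q]] /skew_diagramP /andP[mq ql] [/= /andP[x1 x2] /andP[y1 y2]].
  have [pi|ip] := leqP p i; [left|right]; split.
  - by apply: le_trans x2 _; rewrite ler_nat.
  - by apply: le_trans y1; rewrite ler_nat; apply: leq_trans mq; apply: nth_partition_antitone.
  - by apply: le_trans x1; rewrite ler_nat.
  - apply: le_trans y2 _; rewrite ler_nat; apply: leq_trans ql _; apply: leq_trans sep.
    exact: nth_partition_antitone.
pose f (p : R * R) : R := p.2 - p.1.
have fcont : continuous f.
  by move=> p; apply: cvgB; [exact: cvg_snd|exact: cvg_fst].
have /connected_intervalP fO :=
  connected_continuous_connected conn (continuous_subspaceT fcont).
have inO w : (nth 0%N mu w < nth 0%N lam w)%N ->
    O (w%:R + 2^-1, (nth 0%N mu w)%:R + 2^-1).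
  by move=> row; apply: box_center_interior; apply/skew_diagramP; rewrite leqnn.
have uO := inO u rowu; have vO := inO v rowv.
have mu_u : (c <= nth 0 mu u)%N by apply: nth_partition_antitone.
have mu_v : (nth 0 mu v < c)%N.
  by apply: leq_trans rowv _; apply: leq_trans sep; apply: nth_partition_antitone.
have [] := fO (f (v%:R + 2^-1, (nth 0%N mu v)%:R + 2^-1))
              (f (u%:R + 2^-1, (nth 0%N mu u)%:R + 2^-1))
              _ _ (c%:R - i.+1%:R).
- by exists (v%:R + 2^-1, (nth 0%N mu v)%:R + 2^-1).
- by exists (u%:R + 2^-1, (nth 0%N mu u)%:R + 2^-1).
- rewrite /f /=.
  have : (u%:R : R) <= i%:R by rewrite ler_nat.
  have : (i.+1%:R : R) <= v%:R by rewrite ler_nat.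
  have : (c%:R : R) <= (nth 0%N mu u)%:R by rewrite ler_nat.
  have : ((nth 0%N mu v)%:R : R) <= c%:R by rewrite ler_nat ltnW.
  rewrite -!natr1; lra.
move=> [x y] Oxy; rewrite /f /= => fxy.
have /region xy := interior_subset Oxy.
(* Here [(x, y)] must be the corner itself; increasing both coordinates leaves both quadrants. *)
have [e /= e0 /(_ (x + e / 2, y + e / 2)) sub] := (nbhs_ballP _ _).1 Oxy.
have /sub /region : ball (x, y) e (x + e / 2, y + e / 2).
  by split=> /=; rewrite /ball /= ltr_distlC; lra.
by case: xy => -[? ?] -[] [? ?]; lra.
Qed.

Lemma no_2x2_block_overlap (lam mu : seq nat) (i : nat) :
  is_skew_partition lam mu -> ~ has_2x2_block (skew_diagram lam mu) ->
  (nth 0 lam i.+1 <= (nth 0 mu i).+1)%N.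
Proof.
move=> [plam pmu _] no_block; rewrite leqNgt; apply/negP => wide.
(* Columns [mu_i] and [mu_i + 1] would lie in both rows. *)
apply: no_block; exists i, (nth 0%N mu i).
have := nth_partition_antitone plam (leqnSn i).
have := nth_partition_antitone pmu (leqnSn i).
by split; apply/skew_diagramP; lia.
Qed.

(** Take [r] and [s] to be the first and last nonempty rows; connectedness gives at least one common
    column between neighbours, the absence of blocks at most one. *)
Lemma ribbon_rows (R : realType) (lam mu : seq nat) :
  is_ribbon R lam mu ->
  exists r s : nat,
    [/\ (r <= s)%N, (nth 0 mu r < nth 0 lam r)%N, (nth 0 mu s < nth 0 lam s)%N,
        forall i, (i < r)%N || (s < i)%N -> nth 0%N lam i = nth 0%N mu i
      & forall i, (r <= i < s)%N -> nth 0%N lam i.+1 = (nth 0%N mu i).+1].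
Proof.
move=> [skew conn no_block]; have [_ _ sub] := skew.
pose row i := (nth 0 mu i < nth 0 lam i)%N.
have emptyP i : ~~ row i -> nth 0%N lam i = nth 0%N mu i.
  by rewrite -leqNgt => le; apply/eqP; rewrite eqn_leq le sub.
have exrow : exists i, row i.
  have [[p] /interior_subset [[i j]] /skew_diagramP ij _] := conn.
  by exists i; rewrite /row; lia.
have row_bound i : row i -> (i <= size lam)%N.
  by rewrite /row; case: (ltnP i (size lam)) => [/ltnW //|lami]; rewrite (nth_default _ lami).
case: (ex_minnP exrow) => r rowr minr; case: (ex_maxnP exrow row_bound) => s rows maxs.
exists r, s; split=> //; first exact: minr.
- move=> i out; apply: emptyP; apply/negP => rowi.
  by have := minr i rowi; have := maxs i rowi; lia.
move=> i ris; apply/eqP; rewrite eqn_leq no_2x2_block_overlap //=.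
exact: connected_rows_overlap skew conn ris rowr rows.
Qed.

(** * The Jacobi-Trudi matrix of a ribbon *)

(* The row-to-column matching on which the Jacobi-Trudi matrix of a ribbon has
   entry 1 outside row [r]. *)
Definition ribbon_cycle_fun (k : nat) (r s i : 'I_k) : 'I_k :=
  if i == r then s else
  if (r < i <= s)%N then Ordinal (leq_ltn_trans (leq_pred i) (ltn_ord i)) else i.

Lemma ribbon_cycle_inj (k : nat) (r s : 'I_k) :
  (r <= s)%N -> injective (ribbon_cycle_fun r s).
Proof.
move=> rs i j /(congr1 val); rewrite /ribbon_cycle_fun -!val_eqE /= => e.
by apply: val_inj; move: e; do 4?[case: ifP] => /=; lia.
Qed.

(** The shift writes each Jacobi-Trudi index as a row term minus a column term and makes the parts
    strictly decreasing. *)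
Definition jt_row (lam : seq nat) (k : nat) (i : 'I_k) : int :=
  (nth 0%N lam i)%:Z - i%:Z.

Lemma jt_row_inj (lam : seq nat) (k : nat) :
  is_partition lam -> injective (@jt_row lam k).
Proof.
move=> plam i j; rewrite /jt_row => e; apply: val_inj => /=.
have [ij|ji|//] := ltngtP i j.
  by have := nth_partition_antitone plam (ltnW ij); lia.
by have := nth_partition_antitone plam (ltnW ji); lia.
Qed.

Lemma eval_at_skew_schur (F : comNzRingType) (N : nat) (z : 'rV[F]_N) (lam mu : seq nat) :
  eval_at z (skew_schur lam mu) =
  \det (\matrix_(i < size lam, j < size lam)
    eval_at z (hvar (jt_row lam i - jt_row mu j))).
Proof.
rewrite /skew_schur -det_map_mx; congr determinant; apply/matrixP => i j.
by rewrite !mxE /jt_row; congr (eval_at z (hvar _)); lia.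
Qed.

(* Here [n.+1] is the number of boxes; the indeterminate numbered [n] is
   h_(n+1). *)
Lemma eval_at_ribbon_translate (R : realType) (lam mu : seq nat) :
  is_ribbon R lam mu ->
  exists (n : nat) (e : bool), forall (F : comNzRingType) (N : nat) (i : 'I_N),
    val i = n -> forall (z : 'rV[F]_N) (t : F),
    eval_at (z + t *: delta_mx 0 i) (skew_schur lam mu) =
    eval_at z (skew_schur lam mu) + (-1) ^+ e * t.
Proof.
move=> rib; have [[plam pmu sub] _ _] := rib.
have [r [s [rs rowr rows empty overlap]]] := ribbon_rows rib.
have sk : (s < size lam)%N.
  by rewrite ltnNge; apply/negP => /(nth_default 0%N) e; rewrite e in rows.
pose s' := Ordinal sk; pose r' := Ordinal (leq_ltn_trans rs sk).
pose sigma := perm (ribbon_cycle_inj (rs : (r' <= s')%N)).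
have sr : sigma r' = s' by rewrite permE /ribbon_cycle_fun eqxx.
have mu_rs := nth_partition_antitone pmu rs.
(* No subtraction truncates, since [mu_s <= mu_r < lam_r] and [r <= s]. *)
pose n := (nth 0%N lam r - nth 0%N mu s + (s - r)).-1.
have topE : jt_row lam r' - jt_row mu (sigma r') = n.+1%:Z.
  by rewrite sr /jt_row /= /n; lia.
exists n, (odd_perm sigma) => F N i iE z t.
set z' := z + _; rewrite !eval_at_skew_schur.
rewrite (@det_top_index _ _ _ _ sigma r' (fun m => eval_at z (hvar m))
           (fun m => eval_at z' (hvar m))) ?topE //.
- rewrite -iE !eval_at_hvar !mxE !eqxx mulr1.
  by rewrite addrAC subrr add0r.
- exact: jt_row_inj.
- move=> j jr; rewrite permE /ribbon_cycle_fun (negbTE jr) /jt_row /=.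
  have jr' : (j != r :> nat) by rewrite -[r]/(val r') val_eqE.
  case: ifP => /= [jin|jout]; last by rewrite empty //; lia.
  by have := @overlap j.-1; rewrite prednK; lia.
(* The top value lies below the column terms with [j < r], where [mu_j = lam_j], and above those
   with [j >= r]. *)
- move=> j; apply/eqP; rewrite /jt_row /= => e.
  have [jr|rj] := ltnP j r.
    by have := @empty j; have := nth_partition_antitone plam (ltnW jr); lia.
  by have := nth_partition_antitone pmu rj; lia.
- by rewrite rmorph1.
- by case=> [//|m] _; rewrite rmorph0.
case=> [[|m]|m] mn; [by rewrite !rmorph1 | | by rewrite !rmorph0].
(* Only the factor at [i] could change, and its exponent is 0 because [m] differs from [n]. *)
rewrite /eval_at !mmapU; congr (_ * _); apply: eq_bigr => j _.
rewrite cmU; have [mj|] := eqVneq m (j : nat); last by rewrite !expr0.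
rewrite !mxE; have -> : (j == i) = false.
  by apply/negP => /eqP ji; move: mn; rewrite mj ji iE eqxx.
by rewrite andbF mulr0 addr0.
Qed.

Theorem theorem6p5 (R : realType) (F : finFieldType) (lam mu : seq nat)
    (a : F) :
  is_ribbon R lam mu -> prob (skew_schur lam mu) a = 1 / #|F|%:R.
Proof.
move=> /eval_at_ribbon_translate [n [e shift]].
set f := skew_schur lam mu in shift *.
(* This guarantees a coordinate for h_(n+1) without checking that it occurs in [f]. *)
pose N := maxn (nvars f) n.+1.
have fN : involves_only N f.
  move=> m mf i im; apply: leq_trans (involves_only_nvars mf im) _.
  exact: leq_maxl.
rewrite -(prob_with_eq a fN) /prob_with.
pose i : 'I_N := Ordinal (leq_maxr (nvars f) n.+1).
have sign0 : (-1) ^+ e != 0 :> F by rewrite signr_eq0.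
have := card_fiber_translation a sign0 (shift F N i erefl).
rewrite card_mx mul1n => <-.
have F0 : #|F|%:R != 0 :> rat.
  by rewrite pnatr_eq0 -lt0n; apply/card_gt0P; exists 0.
(* The fibre size is nonzero because its product with [#|F|] is a power of [#|F|]; it then cancels
   from the quotient. *)
set c := #|_|; have c0 : c%:R != 0 :> rat.
  rewrite pnatr_eq0; apply/eqP => c0.
  have := card_fiber_translation a sign0 (shift F N i erefl).
  rewrite -/c c0 mul0n card_mx mul1n => /esym/eqP; rewrite expn_eq0.
  by case/andP => /eqP F00; rewrite F00 eqxx in F0.
by rewrite natrM invfM mulrA divff.
Qed.
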